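(* Let $\mathbb{I}$ be a nontrivial real interval, possibly unbounded. A function $F\colon \mathbb{I}^*\to\mathbb{R}$ is B-preassociative and, for every integer $n\geqslant 1$, the function $F_n$ is symmetric, continuous, and strictly increasing in each argument if and only if there are continuous and strictly increasing functions $f\colon\mathbb{I}\to\mathbb{R}$ and $f_n\colon\mathbb{R}\to\mathbb{R}$ $(n\geqslant 1)$ such that $$F_n(\mathbf{x})=f_n\bigg(\frac{1}{n}\sum_{i=1}^n f(x_i)\bigg)\qquad\text{for every integer } n\geqslant 1 \text{ and every }\mathbf{x}=x_1\cdots x_n\in\mathbb{I}^n.$$
   Context: A nontrivial real interval is one that is nonempty and not a singleton. $\mathbb{I}^*=\bigcup_{n\geqslant 0}\mathbb{I}^n$ is the set of all finite strings over $\mathbb{I}$ (including the empty string $\varepsilon$, $\mathbb{I}^0=\{\varepsilon\}$), with concatenation written as juxtaposition, and $|\mathbf{x}|$ is the length of $\mathbf{x}$. $F_n=F|_{\mathbb{I}^n}$ is the $n$-ary part of $F$. $F_n$ is symmetric if it is invariant under any permutation of its arguments. A function $F\colon \mathbb{I}^*\to\mathbb{R}$ is B-preassociative if for all $\mathbf{x},\mathbf{y},\mathbf{y}',\mathbf{z}\in \mathbb{I}^*$ with $|\mathbf{y}|=|\mathbf{y}'|$, $F(\mathbf{y})=F(\mathbf{y}')$ implies $F(\mathbf{x}\mathbf{y}\mathbf{z})=F(\mathbf{x}\mathbf{y}'\mathbf{z})$.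
   Formalization: The functions f_n are required to be continuous and strictly increasing only on the range f(I), not on all of ℝ; with f_n on ℝ the claim fails, e.g. for I = ]0,1[ and F_n(x) = 1/(1 − mean of x). *)

(* Defs.v *)
From HB Require Import structures.
From mathcomp Require Import all_boot all_order all_algebra all_fingroup.
From mathcomp Require Import all_classical all_reals all_analysis.

Set Implicit Arguments.
Unset Strict Implicit.
Unset Printing Implicit Defensive.

Import Order.TTheory GRing.Theory Num.Theory.
Import numFieldNormedType.Exports.

Local Open Scope classical_set_scope.
Local Open Scope ring_scope.

Definition nontrivial_interval (R : realType) (I : set R) : Prop :=
  [/\ is_interval I, I !=set0 & forall a : R, I <> [set a]].

(* A function on finite strings over I is encoded as a total function on
   [seq R]; every property below only involves its values on strings over I. *)
Definition strings (R : realType) (I : set R) (s : seq R) : Prop :=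
  forall t : R, t \in s -> I t.

Definition B_preassociative (R : realType) (I : set R) (F : seq R -> R) : Prop :=
  forall x y y' z : seq R,
    strings I x -> strings I y -> strings I y' -> strings I z ->
    size y = size y' -> F y = F y' ->
    F (x ++ y ++ z) = F (x ++ y' ++ z).

(* Row vectors stand for strings of length n, so that the topology on I^n is
   the one induced by 'rV[R]_n. *)
Definition cube (R : realType) (I : set R) (n : nat) : set 'rV[R]_n :=
  [set x | forall i : 'I_n, I (x ord0 i)].
Arguments cube {R} I n.

Definition nary_part (R : realType) (F : seq R -> R) (n : nat)
  (x : 'rV[R]_n) : R := F [seq x ord0 i | i <- enum 'I_n].
Arguments nary_part {R} F n x.

Definition symmetric_on (R : realType) (I : set R) (n : nat)
    (G : 'rV[R]_n -> R) : Prop :=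
  forall (s : 'S_n) (x : 'rV[R]_n), cube I n x -> G (col_perm s x) = G x.

Definition strictly_increasing_in_each_arg (R : realType) (I : set R) (n : nat)
    (G : 'rV[R]_n -> R) : Prop :=
  forall (i : 'I_n) (x y : 'rV[R]_n), cube I n x -> cube I n y ->
    (forall j : 'I_n, j != i -> x ord0 j = y ord0 j) ->
    x ord0 i < y ord0 i -> G x < G y.

(* The outer functions f_n of a quasi-arithmetic representation are required to
   satisfy this on A = f(I), the range of the means of f, and not on all of R:
   for I = ]0, 1[ and F_n(x) = 1 / (1 - mean x), no increasing extension of the
   f_n to R exists. *)
Definition continuous_strictly_increasing_on (R : realType) (A : set R)
    (g : R -> R) : Prop :=
  {within A, continuous g} /\
  (forall x y : R, A x -> A y -> x < y -> g x < g y).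

(* Main.v *)
Require Import Defs.
From HB Require Import structures.
From mathcomp Require Import all_boot all_order all_algebra all_fingroup.
From mathcomp Require Import all_classical all_reals all_analysis.
From mathcomp Require Import zify ring lra.
Import Order.TTheory GRing.Theory Num.Theory.
Import numFieldNormedType.Exports.
Local Open Scope classical_set_scope.
Local Open Scope ring_scope.

(** Symmetry and B-preassociativity turn the values of F into an order on an
    abelian group, and the inner function f is an additive representation of
    that order by real numbers.

    Two strings of the same length are compared through their values.
    B-preassociativity lets a common substring be appended to both sides of an
    equality F x = F y, and [diagonal_mean] (each string is equivalent to a
    constant string, by the intermediate value theorem) together with
    monotonicity upgrades this to strict inequalities: appending or cancelling
    a common substring neither creates nor destroys an inequality.  By symmetry
    a string matters only through the multiplicity function [cnt] of its
    letters, so the comparison of x with y depends on the integer-valued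
    function cnt x - cnt y alone.  These differences form a totally preordered
    abelian group, and [cone] is its set of nonnegative elements.

    Continuity of the binary part makes this group Archimedean
    ([cone_archimedean]).  Hoelder's theorem ([holder_embedding]) then yields an
    additive monotone map phi into the reals; f t is phi of the class of the
    letter t minus a base letter a.  Comparing F x with F y thus compares the
    sums of f.  The Archimedean property makes f strictly increasing, and the
    strict inequality F (c ... c a) < F (c ... c b) is stable under small moves
    of the n letters c, which bounds the variation of f near c by 1/n.

    If m is the mean of x, then F x = F (m ... m) gives sum f(x_i) = n f(m), so
    the arithmetic mean of the f(x_i) is f(m), and f_n must be the map sending
    f(m) to F (m ... m).  It is increasing and its image is an interval, hence
    it is continuous ([increasing_interval_continuous]).

    Conversely f(I) is an interval, so the means of f stay in the domain where
    f_n is injective, continuous and increasing; equality of two values of f_n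
    is equality of two sums, which is preserved by concatenation. *)

(** * Hoelder's embedding theorem *)

Section Holder.
(* The preorder lives on the subgroup S of V, C is its cone of nonnegative
   elements and u is an order unit. *)
Context {R : realType} {V : zmodType} (S C : set V) (u : V).
Hypothesis Su : S u.
Hypothesis SB : forall v w, S v -> S w -> S (v - w).
Hypothesis CD : forall v w, C v -> C w -> C (v + w).
Hypothesis C_total : forall v, S v -> C v \/ C (- v).
Hypothesis uN : ~ C (- u).
Hypothesis u_unit : forall v, S v -> exists n : nat, C (u *+ n - v).

Let S0 : S 0. Proof. by rewrite -(subrr u); exact: SB. Qed.
Let SN v : S v -> S (- v). Proof. by rewrite -[- v]add0r; exact: SB. Qed.
Let SD v w : S v -> S w -> S (v + w).
Proof. by move=> Sv Sw; rewrite -[w]opprK; apply: SB => //; exact: SN. Qed.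
Let SMn v n : S v -> S (v *+ n).
Proof. by move=> Sv; elim: n => [|n ih]; rewrite ?mulr0n ?mulrS//; exact: SD. Qed.
Let SMz v (z : int) : S v -> S (v *~ z).
Proof.
by case: z => n Sv; rewrite ?NegzE ?mulrNz -!pmulrn//; [exact: SMn|exact/SN/SMn].
Qed.
Let C0 : C 0. Proof. by have [//|] := C_total _ S0; rewrite oppr0. Qed.
Let CMn v n : C v -> C (v *+ n).
Proof. by move=> Cv; elim: n => [|n ih]; rewrite ?mulr0n ?mulrS//; exact: CD. Qed.
Let Cu : C u. Proof. by have [|/uN] := C_total _ Su. Qed.

Let Cmulz_ge0 (p : int) : C (u *~ p) -> 0 <= p.
Proof.
case: p => // n; rewrite NegzE mulrNz -pmulrn => Cn; exfalso; apply: uN.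
have -> : - u = - (u *+ n.+1) + u *+ n by rewrite mulrS opprD -addrA addNr addr0.
by apply: CD => //; exact: CMn.
Qed.

(** The lower Dedekind cut of the quotient of v by u. *)
Let cut v : set R :=
  [set r | exists (p : int) (q : nat),
     [/\ (0 < q)%N, r = p%:~R / q%:R & C (v *+ q - u *~ p)]].

Let phi v := sup (cut v).

Let cut_ub v n : C (u *+ n - v) -> ubound (cut v) n%:R.
Proof.
move=> Cn _ [p [q [q0 -> Cpq]]].
rewrite ler_pdivrMr ?ltr0n// -natrM.
have : C (u *~ ((n * q)%:Z - p)).
  have -> : u *~ ((n * q)%:Z - p) = (u *+ n - v) *+ q + (v *+ q - u *~ p).
    by rewrite mulrzBr -pmulrn mulrnBl mulrnA addrA subrK.
  by apply: CD => //; exact: CMn.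
by move/Cmulz_ge0; rewrite subr_ge0 -(ler_int R).
Qed.

Let cut_nonempty v : S v -> cut v !=set0.
Proof.
move=> /SN /u_unit[n]; rewrite opprK => Cn; exists (- n%:R), (- n%:Z), 1%N.
by split; rewrite ?divr1 ?rmorphN// mulrNz opprK mulr1n addrC.
Qed.

Let cut_sup v : S v -> has_sup (cut v).
Proof.
move=> Sv; split; first exact: cut_nonempty.
by have [n /cut_ub] := u_unit _ Sv; exists n%:R.
Qed.

Let le_phi v r : S v -> cut v r -> r <= phi v.
Proof. by move=> Sv; apply: sup_upper_bound; exact: cut_sup. Qed.

Let cutD v w r s : cut v r -> cut w s -> cut (v + w) (r + s).
Proof.
move=> [p [q [q0 -> Cpq]]] [p' [q' [q'0 -> Cpq']]].
exists (p * q' + p' * q), (q * q')%N; split; first by rewrite muln_gt0 q0.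
  rewrite rmorphD !rmorphM/= -!pmulrn.
  by field; rewrite !pnatr_eq0 -!lt0n q0 q'0.
have -> : (v + w) *+ (q * q') - u *~ (p * q' + p' * q) =
    (v *+ q - u *~ p) *+ q' + (w *+ q' - u *~ p') *+ q.
  rewrite !mulrnBl -!mulrnA mulrzDr !mulrzA mulrnDl -!pmulrn.
  by rewrite (mulnC q' q) opprD addrACA.
by apply: CD; exact: CMn.
Qed.

Let phi_superadd v w : S v -> S w -> phi v + phi w <= phi (v + w).
Proof.
move=> Sv Sw; rewrite -lerBrDr; apply: ge_sup; first exact: cut_nonempty.
move=> r vr; rewrite lerBrDr -lerBrDl; apply: ge_sup; first exact: cut_nonempty.
by move=> s ws; rewrite lerBrDl; apply: le_phi (SD _ _ Sv Sw) _; exact: cutD.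
Qed.

(** Totality enters here: a rational strictly between phi v and - phi (- v) would
    belong neither to the cut of v nor, negated, to the cut of - v. *)
Let phiN_ge v : S v -> - phi v <= phi (- v).
Proof.
move=> Sv; rewrite leNgt; apply/negP => lt; have lt' : phi v < - phi (- v) by lra.
have [r /[!in_itv]/= /andP[ltr gtr]] := rat_in_itvoo lt'.
pose p := numq r; pose q := `|denq r|%N.
have q0 : (0 < q)%N by rewrite absz_gt0 denq_neq0.
have rE : ratr r = p%:~R / q%:R :> R.
  by rewrite /ratr /q -[in RHS](absz_id) pmulrn absz_id absz_denq.
have [|Cr] := C_total (v *+ q - u *~ p) (SB _ _ (SMn _ _ Sv) (SMz _ _ Su)).
  move=> Cr; have := le_phi v (ratr r) Sv; rewrite leNgt ltr => /(_ _)/negP.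
  by apply => //; exists p, q.
have : - ratr r <= phi (- v); last by lra.
apply: le_phi (SN _ Sv) _; exists (- p), q; split=> //.
  by rewrite rE rmorphN mulNr.
by move: Cr; rewrite opprB mulrNz opprK mulNrn addrC.
Qed.

(** The quotient by u, as a real number, is superadditive because cuts add up,
    and it is compatible with opposites; these two facts force additivity. *)
Lemma holder_embedding : exists phi : V -> R,
  [/\ forall v w, S v -> S w -> phi (v + w) = phi v + phi w,
      forall v, S v -> C v -> 0 <= phi v & phi u = 1].
Proof.
exists phi; split=> [v w Sv Sw|v Sv Cv|].
- apply/eqP; rewrite eq_le phi_superadd// andbT.
  have := phi_superadd (v + w) (- w) (SD _ _ Sv Sw) (SN _ Sw).
  by rewrite addrK; have := phiN_ge w Sw; lra.
- by apply: le_phi => //; exists 0, 1%N; rewrite mul0r mulr0z subr0 mulr1n.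
- apply/eqP; rewrite eq_le; apply/andP; split.
    apply: ge_sup; first exact: cut_nonempty.
    by apply: (cut_ub u 1%N); rewrite mulr1n subrr.
  by apply: le_phi => //; exists 1, 1%N; rewrite divr1 subrr.
Qed.
End Holder.

(** * Monotone and continuous functions on intervals *)

Lemma within_continuous_epsP {R : realType} (A : set R) (h : R -> R) :
  {within A, continuous h} <->
  forall c e, A c -> 0 < e -> exists2 d, 0 < d &
    forall t, A t -> `|t - c| < d -> `|h t - h c| < e.
Proof.
rewrite subspace_continuousP; split=> [hc c e Ac e0|hc c Ac].
  have /cvgrPdist_lt/(_ e e0) := hc c Ac.
  move=> /nbhs_ballP[d d0 dh]; exists d => // t At tc.
  by rewrite distrC; apply: dh => //; rewrite /ball/= distrC.
apply/cvgrPdist_lt => e e0; have [d d0 dh] := hc c e Ac e0.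
apply/nbhs_ballP; exists d => //= t; rewrite /ball/= distrC => tc At.
by rewrite distrC; exact: dh.
Qed.

Lemma image_interval {R : realType} (A : set R) (h : R -> R) :
  is_interval A -> {within A, continuous h} -> is_interval (h @` A).
Proof.
by move=> /connected_intervalP cA ch; apply/connected_intervalP;
  exact: connected_continuous_connected.
Qed.

(** A jump of an increasing function leaves a gap in its image.  The domain A may
    be any set, which makes the lemma suitable for inverse functions. *)
Lemma increasing_interval_continuous {R : realType} (A : set R) (h : R -> R) :
  (forall x y, A x -> A y -> x < y -> h x < h y) ->
  is_interval (h @` A) -> {within A, continuous h}.
Proof.
move=> hmono hA; apply/within_continuous_epsP => c e Ac e0.
have hle x y : A x -> A y -> x <= y -> h x <= h y.
  by move=> Ax Ay; rewrite le_eqVlt => /predU1P[->//|/hmono/ltW]; exact.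
have [d1 d10 hd1] : exists2 d, 0 < d & forall t, A t -> t < c + d -> h t < h c + e.
  have [[s [As cs hs]]|ns] :=
      pselect (exists s, [/\ A s, c < s & h s < h c + e]).
    exists (s - c); first by rewrite subr_gt0.
    by move=> t At; rewrite addrC subrK => /hmono -/(_ At As) /lt_trans; exact.
  exists 1 => // t At _; rewrite ltNge; apply/negP => het; apply: ns.
  have [|||s As hs] := hA (h c) (h t) _ _ (h c + e / 2).
  - by exists c.
  - by exists t.
  - by apply/andP; split; lra.
  exists s; split => //; last by lra.
  by rewrite ltNge; apply/negP => /hle -/(_ As Ac); lra.
have [d2 d20 hd2] : exists2 d, 0 < d & forall t, A t -> c - d < t -> h c - e < h t.
  have [[s [As cs hs]]|ns] :=
      pselect (exists s, [/\ A s, s < c & h c - e < h s]).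
    exists (c - s); first by rewrite subr_gt0.
    by move=> t At; rewrite opprB addrC subrK => /hmono -/(_ As At); apply: lt_trans.
  exists 1 => // t At _; rewrite ltNge; apply/negP => het; apply: ns.
  have [|||s As hs] := hA (h t) (h c) _ _ (h c - e / 2).
  - by exists t.
  - by exists c.
  - by apply/andP; split; lra.
  exists s; split => //; last by lra.
  by rewrite ltNge; apply/negP => /hle -/(_ Ac As); lra.
exists (Order.min d1 d2); first by rewrite lt_min d10.
move=> t At; rewrite lt_min !ltr_distl => /andP[/andP[_ u1] /andP[u2 _]].
by rewrite hd1// hd2.
Qed.

(** * Strings and the multiplicities of their letters *)

Section Strings.
Context {R : realType} {I : set R}.

Lemma strings_nil : strings I [::]. Proof. by []. Qed.

Lemma strings_cons t s : strings I (t :: s) <-> I t /\ strings I s.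
Proof.
split=> [ts|[It Is] r]; last by rewrite inE => /predU1P[->//|]; exact: Is.
split; first by apply: ts; rewrite mem_head.
by move=> r rs; apply: ts; rewrite inE rs orbT.
Qed.

Lemma strings_cat s t : strings I s -> strings I t -> strings I (s ++ t).
Proof. by move=> Is It r; rewrite mem_cat => /orP[/Is|/It]. Qed.

Lemma strings_nseq n t : I t -> strings I (nseq n t).
Proof. by move=> It r; rewrite mem_nseq => /andP[_ /eqP->]. Qed.

(** The image of s in the free abelian group on R, seen among the functions from R
    to int so that differences of strings are computed pointwise. *)
Definition cnt (s : seq R) : R -> int := fun t => (count_mem t s)%:Z.

Lemma cnt_cat s t : cnt (s ++ t) = cnt s + cnt t.
Proof. by apply/funext => r; rewrite /cnt count_cat PoszD. Qed.

Lemma cnt_cons t s : cnt (t :: s) = cnt [:: t] + cnt s.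
Proof. by rewrite -cat1s cnt_cat. Qed.

Lemma cnt_inj s t : cnt s = cnt t -> perm_eq s t.
Proof.
move=> st; apply/allP => r _ /=.
by have := congr1 (@^~ r) st; rewrite /cnt => -[->].
Qed.

End Strings.

(** * The Archimedean ordered group of a preassociative function *)

Section Ordering.
Context {R : realType} {I : set R} {F : seq R -> R}.
Hypothesis I_itv : is_interval I.
Hypothesis F_perm : forall s t, strings I s -> perm_eq s t -> F s = F t.
Hypothesis F_mono : forall u v z, I u -> I v -> strings I z ->
  u < v -> F (u :: z) < F (v :: z).
Hypothesis F_cont : forall n z, strings I z -> (0 < n + size z)%N ->
  {within I, continuous (fun t => F (nseq n t ++ z))}.
Hypothesis F_preassoc : forall x y z, strings I x -> strings I y ->
  strings I z -> size x = size y -> F x = F y -> F (x ++ z) = F (y ++ z).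

Local Hint Resolve strings_cat strings_nseq strings_nil : core.
Local Hint Extern 1 (strings I (_ :: _)) => (apply/strings_cons; split) : core.

Let nseq_cat_cons n v w z : I v -> I w -> strings I z ->
  F (v :: nseq n w ++ z) = F (nseq n w ++ v :: z).
Proof.
move=> Iv Iw Iz; apply: F_perm; first by auto.
by rewrite -[v :: z]cat1s -cat1s perm_catCA.
Qed.

Let nseq_cat_le n u v z : I u -> I v -> strings I z ->
  u <= v -> F (nseq n u ++ z) <= F (nseq n v ++ z).
Proof.
move=> Iu Iv; rewrite le_eqVlt => + /predU1P[->//|uv].
elim: n z => [//|n ih] z Iz /=.
apply: (@le_trans _ _ (F (v :: nseq n u ++ z))); first by apply/ltW/F_mono; auto.
by rewrite !nseq_cat_cons//; apply: ih; auto.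
Qed.

Lemma nseq_cat_lt n u v z : (0 < n)%N -> I u -> I v -> strings I z ->
  u < v -> F (nseq n u ++ z) < F (nseq n v ++ z).
Proof.
case: n => // n _ Iu Iv Iz uv.
apply: (@lt_le_trans _ _ (F (v :: nseq n u ++ z))).
  by rewrite /=; apply: F_mono; auto.
by rewrite /= !nseq_cat_cons//; apply: nseq_cat_le; auto; exact: ltW.
Qed.

(** By induction: if the tail of x is equivalent to m' ... m', then x is equivalent
    to m' ... m' t, which lies between t ... t and m' ... m'; the intermediate
    value theorem along the diagonal concludes. *)
Lemma diagonal_mean x : strings I x -> (0 < size x)%N ->
  exists2 m, I m & F x = F (nseq (size x) m).
Proof.
elim: x => // t x ih /strings_cons[It Ix] _.
have [/size0nil ->|/ih] := posnP (size x); first by exists t.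
move=> /(_ Ix)[m' Im' xm'].
have -> : F (t :: x) = F (nseq (size x) m' ++ [:: t]).
  rewrite -(F_preassoc x) ?size_nseq//; auto.
  by apply: F_perm; [auto|rewrite -cat1s perm_catC].
have Et w : I w -> F (nseq (size x).+1 w) = F (nseq (size x) w ++ [:: w]).
  by move=> Iw; rewrite -addn1 nseqD.
have Etm : F (nseq (size x) m' ++ [:: t]) = F (nseq 1 t ++ nseq (size x) m').
  by apply: F_perm; [auto|rewrite perm_catC].
have Emm : F (nseq (size x).+1 m') = F (nseq 1 m' ++ nseq (size x) m') by [].
have cd : {within I, continuous (fun s => F (nseq (size x).+1 s))}.
  rewrite (_ : (fun s => _) = fun s => F (nseq (size x).+1 s ++ [::])).
    by apply: F_cont.
  by apply/funext => s; rewrite cats0.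
have itv := image_interval _ _ I_itv cd.
have [tm|mt] := leP t m'.
  have [|||m Im <-] := itv (F (nseq (size x).+1 t)) (F (nseq (size x).+1 m')) _ _
    (F (nseq (size x) m' ++ [:: t])); [by exists t|by exists m'| |by exists m].
  by rewrite Et// nseq_cat_le; auto; rewrite Etm Emm; apply: nseq_cat_le; auto.
have [|||m Im <-] := itv (F (nseq (size x).+1 m')) (F (nseq (size x).+1 t)) _ _
  (F (nseq (size x) m' ++ [:: t])); [by exists m'|by exists t| |by exists m].
rewrite [X in _ && (_ <= X)]Et// [X in _ && X]nseq_cat_le ?(ltW mt); auto.
by rewrite andbT Etm Emm; apply: nseq_cat_le; auto; exact: ltW.
Qed.

(** Preassociativity speaks of equalities only; replacing x and y by constant
    strings reduces strict inequalities to a comparison of two letters. *)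
Let cat_lt x y z : strings I x -> strings I y -> strings I z ->
  size x = size y -> F x < F y -> F (x ++ z) < F (y ++ z).
Proof.
move=> Ix Iy Iz xy; have [x0|x0] := posnP (size x).
  by rewrite (size0nil x0) (size0nil (esym (etrans (esym x0) xy))) ltxx.
have [m Im xm] := diagonal_mean _ Ix x0.
have [m' Im' ym'] := diagonal_mean y Iy (eq_ind _ (leq 1) x0 _ xy).
rewrite (F_preassoc x (nseq (size x) m)) ?size_nseq//; auto.
rewrite (F_preassoc y (nseq (size y) m')) ?size_nseq//; auto.
rewrite xm ym' -xy => lt; apply: nseq_cat_lt => //.
rewrite ltNge; apply/negP => m'm.
have := nseq_cat_le (size x) _ _ _ Im' Im strings_nil m'm.
by rewrite !cats0 leNgt lt.
Qed.

Let cat_le x y z : strings I x -> strings I y -> strings I z ->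
  size x = size y -> (F (x ++ z) <= F (y ++ z)) = (F x <= F y).
Proof.
move=> Ix Iy Iz xy; have [lt|lt|eq] := ltgtP (F x) (F y).
- by rewrite ltW// cat_lt.
- by apply/negbTE; rewrite -ltNge cat_lt.
- by rewrite (F_preassoc x y) ?lexx.
Qed.

Definition balanced : set (R -> int) := [set g | exists x y,
  [/\ strings I x, strings I y, size x = size y & g = cnt x - cnt y]].

Definition cone : set (R -> int) := [set g | exists x y,
  [/\ strings I x, strings I y, size x = size y, F y <= F x & g = cnt x - cnt y]].

(** Membership in the cone does not depend on the strings chosen to represent the
    difference: if x - y and x' - y' agree, then x y' and y x' are permutations of
    each other, and common letters cancel. *)
Let cone_le x y : strings I x -> strings I y -> size x = size y ->
  cone (cnt x - cnt y) -> F y <= F x.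
Proof.
move=> Ix Iy xy [x' [y' [Ix' Iy' xy' le E]]].
have Exy : perm_eq (x ++ y') (y ++ x').
  apply: cnt_inj; rewrite !cnt_cat -[cnt x](subrK (cnt y)) E.
  by rewrite addrAC subrK addrC.
rewrite -(cat_le _ _ y')//.
have -> : F (x ++ y') = F (x' ++ y).
  apply: F_perm; first by auto.
  by rewrite (permPl Exy) perm_catC.
rewrite (F_perm (y ++ y') (y' ++ y)) ?cat_le//; auto.
by rewrite perm_catC.
Qed.

Let coneD v w : cone v -> cone w -> cone (v + w).
Proof.
move=> [x [y [Ix Iy xy le ->]]] [x' [y' [Ix' Iy' xy' le' ->]]].
exists (x ++ x'), (y ++ y'); split; auto; first by rewrite !size_cat xy xy'.
  apply: (@le_trans _ _ (F (x ++ y'))); first by rewrite cat_le.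
  rewrite (F_perm (x ++ y') (y' ++ x)); auto; last by rewrite perm_catC.
  rewrite (F_perm (x ++ x') (x' ++ x)); auto; last by rewrite perm_catC.
  by rewrite cat_le.
by rewrite !cnt_cat opprD addrACA.
Qed.

Let balancedB v w : balanced v -> balanced w -> balanced (v - w).
Proof.
move=> [x [y [Ix Iy xy ->]]] [x' [y' [Ix' Iy' xy' ->]]].
exists (x ++ y'), (y ++ x'); split; auto; first by rewrite !size_cat xy xy'.
by rewrite !cnt_cat opprB opprD addrACA.
Qed.

Let cone_total v : balanced v -> cone v \/ cone (- v).
Proof.
move=> [x [y [Ix Iy xy ->]]]; have [le|/ltW le] := leP (F y) (F x).
  by left; exists x, y.
by right; exists y, x; rewrite opprB.
Qed.

Let cone_intro x y v : strings I x -> strings I y -> size x = size y ->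
  F y <= F x -> v = cnt x - cnt y -> cone v.
Proof. by exists x, y. Qed.

(** The letters t such that t - c is bounded by a multiple of b - a have a
    supremum s.  Since F(s a) < F(s b), continuity shows that letters close to s
    differ by less than b - a, so that one more step b - a goes from below s to s,
    and from s beyond s unless s = d. *)
Lemma cone_archimedean a b c d : I a -> I b -> I c -> I d -> a < b ->
  exists n, cone ((cnt [:: b] - cnt [:: a]) *+ n - (cnt [:: d] - cnt [:: c])).
Proof.
move=> Ia Ib Ic Id ab; set u := cnt [:: b] - cnt [:: a].
have [dc|cd] := leP d c.
  exists 0%N; apply: (cone_intro [:: c] [:: d]); auto; last first.
    by rewrite mulr0n sub0r opprB.
  by have := nseq_cat_le 1 _ _ _ Id Ic strings_nil dc.
pose T := [set t |
  [/\ I t, t <= d & exists n, cone (u *+ n - (cnt [:: t] - cnt [:: c]))]].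
have step t t' : I t' -> t' <= d -> T t -> F [:: t'; a] <= F [:: t; b] -> T t'.
  move=> It' t'd [It _ [n Cn]] le; split=> //; exists n.+1.
  have -> : u *+ n.+1 - (cnt [:: t'] - cnt [:: c]) =
     (cnt [:: t; b] - cnt [:: t'; a]) + (u *+ n - (cnt [:: t] - cnt [:: c])).
    rewrite mulrS (cnt_cons t [:: b]) (cnt_cons t' [:: a]); move: (u *+ n) => un.
    by apply/funext => r; rewrite /u !fctE; ring.
  by apply: coneD => //; apply: (cone_intro [:: t; b] [:: t'; a]); auto.
have Tc : T c.
  split; [by []|exact: ltW|exists 0%N].
  by rewrite mulr0n subrr subr0; apply: (cone_intro [::] [::]); auto; rewrite subrr.
have supT : has_sup T by split; [exists c|exists d => t []].
pose s := sup T.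
have cs : c <= s by apply: sup_upper_bound.
have sd : s <= d by apply: ge_sup; [exists c|move=> t []].
have Is : I s by apply: (I_itv c d) => //; rewrite cs sd.
have gap : F [:: s; a] < F [:: s; b].
  rewrite (F_perm _ [:: a; s]) ?(F_perm [:: s; b] [:: b; s]); auto.
  - by rewrite -[[:: s; b]]/([:: s] ++ [:: b]) perm_catC.
  - by rewrite -[[:: s; a]]/([:: s] ++ [:: a]) perm_catC.
have nearF w : I w -> exists2 e, 0 < e & forall t, I t -> `|t - s| < e ->
    `|F [:: t; w] - F [:: s; w]| < F [:: s; b] - F [:: s; a].
  move=> Iw; have Iw1 : strings I [:: w] by auto.
  have /within_continuous_epsP := F_cont 1 [:: w] Iw1 isT.
  by apply => //; rewrite subr_gt0.
have [e e0 be] := nearF b Ib.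
have Ts : T s.
  have [t Tt st] := sup_adherent e0 supT; have [It _ _] := Tt.
  apply: (step t) => //; apply/ltW.
  have ts : t <= s by apply: sup_upper_bound.
  have /(be t It) : `|t - s| < e by rewrite -/s in st; rewrite ltr_distl; lra.
  by rewrite ltr_distl; lra.
have [e' e'0 ae] := nearF a Ia.
suff -> : d = s by case: Ts.
apply/eqP; rewrite eq_le sd andbT leNgt; apply/negP => sd'.
pose t := Order.min d (s + e' / 2).
have st : s < t by rewrite lt_min sd'/=; lra.
have td : t <= d by rewrite ge_min lexx.
have It : I t by apply: (I_itv c d) => //; rewrite td (le_trans cs (ltW st)).
have : T t.
  apply: (step s) => //; apply/ltW.
  have /(ae t It) : `|t - s| < e'.
    have : t <= s + e' / 2 by rewrite ge_min lexx orbT.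
    by rewrite ltr_distl; lra.
  by rewrite ltr_distl; lra.
by move/(sup_upper_bound supT); rewrite -/s leNgt st.
Qed.

Section Representation.
Context {a b : R}.
Hypotheses (Ia : I a) (Ib : I b) (ab : a < b).
Let u := cnt [:: b] - cnt [:: a].

Let balanced_u : balanced u. Proof. by exists [:: b], [:: a]; split; auto. Qed.

Let u_pos : ~ cone (- u).
Proof.
rewrite opprB => Cu; have := F_mono a b [::] Ia Ib strings_nil ab.
by rewrite ltNge cone_le//; auto.
Qed.

Let u_unit v : balanced v -> exists n, cone (u *+ n - v).
Proof.
move=> [x [y [Ix Iy xy ->]]]; elim: x y xy Ix Iy => [|d x ih] [|c y]//.
  exists 0%N; rewrite mulr0n !subrr.
  by apply: (cone_intro [::] [::]); rewrite ?subrr.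
move=> [xy] /strings_cons[Id Ix] /strings_cons[Ic Iy].
have [n Cn] := ih y xy Ix Iy; have [k Ck] := cone_archimedean a b c d Ia Ib Ic Id ab.
exists (k + n)%N; rewrite (cnt_cons d) (cnt_cons c) mulrnDr.
set p := cnt [:: d] in Ck *; set q := cnt [:: c] in Ck *.
have -> : u *+ k + u *+ n - (p + cnt x - (q + cnt y)) =
   (u *+ k - (p - q)) + (u *+ n - (cnt x - cnt y)).
  by apply/funext => r; rewrite !fctE; ring.
exact: coneD.
Qed.

(** The function f is Hoelder's map applied to the difference of a letter and the
    base letter a, with b - a as unit.  The Archimedean property applied to
    d - c, with c < d, shows that a multiple of d - c exceeds the unit, whence
    strict monotonicity. *)
Lemma additive_representation : exists f : R -> R,
  continuous_strictly_increasing_on I f /\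
  forall x y, strings I x -> strings I y -> size x = size y -> F x <= F y ->
    \sum_(t <- x) f t <= \sum_(t <- y) f t.
Proof.
have [phi [phiD phi_ge0 phi_u]] :=
  @holder_embedding R _ balanced cone u balanced_u balancedB coneD cone_total
    u_pos u_unit.
pose f t := phi (cnt [:: t] - cnt [:: a]).
have dI x y : strings I x -> strings I y -> size x = size y ->
    balanced (cnt x - cnt y).
  by exists x, y.
have d0 : balanced 0 by rewrite -(subrr u); exact: balancedB.
have phi0 : phi 0 = 0 by have := phiD 0 0 d0 d0; rewrite addr0; lra.
have balancedMn v n : balanced v -> balanced (v *+ n).
  move=> dv; elim: n => // n ih.
  have -> : v *+ n.+1 = v *+ n - (0 - v) by rewrite sub0r opprK mulrSr.
  by do 2!apply: balancedB => //.
have phiMn v n : balanced v -> phi (v *+ n) = phi v *+ n.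
  move=> dv; elim: n => [|n ih]; first by rewrite !mulr0n phi0.
  by rewrite !mulrS phiD ?ih//; exact: balancedMn.
have phi_f c d : I c -> I d -> phi (cnt [:: d] - cnt [:: c]) = f d - f c.
  move=> Ic Id; apply/eqP; rewrite eq_sym subr_eq -phiD; [|apply: dI; auto..].
  by rewrite addrA subrK.
have f_sum x y : strings I x -> strings I y -> size x = size y ->
    phi (cnt x - cnt y) = \sum_(t <- x) f t - \sum_(t <- y) f t.
  elim: x y => [|d x ih] [|c y]//; first by rewrite subrr phi0 !big_nil subrr.
  move=> /strings_cons[Id Ix] /strings_cons[Ic Iy] [xy].
  rewrite !big_cons (cnt_cons d) (cnt_cons c) opprD addrACA phiD; [|apply: dI; auto..].
  by rewrite ih// phi_f// opprD addrACA.
have sum_le x y : strings I x -> strings I y -> size x = size y ->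
    F x <= F y -> \sum_(t <- x) f t <= \sum_(t <- y) f t.
  move=> Ix Iy xy le; rewrite -subr_ge0 -f_sum//.
  by apply: phi_ge0; [exact: dI|exact: (cone_intro y x)].
have f_mono c d : I c -> I d -> c < d -> f c < f d.
  move=> Ic Id cd; have [n Cn] := cone_archimedean c d a b Ic Id Ia Ib cd.
  have dcd : balanced (cnt [:: d] - cnt [:: c]) by apply: dI; auto.
  have := phi_ge0 _ (balancedB _ _ (balancedMn _ n dcd) balanced_u) Cn.
  have -> : phi ((cnt [:: d] - cnt [:: c]) *+ n - u) = (f d - f c) *+ n - 1.
    have dn := balancedMn _ n dcd; apply/eqP; rewrite eq_sym subr_eq -phi_u.
    by rewrite -phiD ?subrK ?phiMn ?phi_f//; exact: balancedB.
  rewrite subr_ge0 => n1; rewrite -subr_gt0 ltNge; apply/negP => le0.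
  by have := le_trans n1 (mulrn_wle0 n le0); rewrite ler10.
(* n (c - d) is at most b - a in the group, so f c - f d is at most 1 / n. *)
have f_slope n c d : I c -> I d ->
    F (nseq n c ++ [:: a]) <= F (nseq n d ++ [:: b]) ->
    n%:R * (f c - f d) <= 1.
  move=> Ic Id /sum_le; rewrite !size_cat !size_nseq !big_cat !big_seq1 !big_nseq.
  rewrite !iter_addr_0 -!(mulr_natl (f _)) => le.
  have Ica : strings I (nseq n c ++ [:: a]) by auto.
  have Idb : strings I (nseq n d ++ [:: b]) by auto.
  have := phi_f a b Ia Ib; rewrite phi_u; have := le Ica Idb erefl. move=> /=; lra.
exists f; split=> //; split=> //.
apply/within_continuous_epsP => c e Ic e0.
have [n ne] : exists n : nat, e^-1 < n.+1%:R.
  by exists (Num.truncn e^-1); rewrite truncnS_gt.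
have gap : F (nseq n.+1 c ++ [:: a]) < F (nseq n.+1 c ++ [:: b]).
  by rewrite -!nseq_cat_cons//; apply: F_mono; auto.
have nearF w : I w -> exists2 d, 0 < d & forall t, I t -> `|t - c| < d ->
    `|F (nseq n.+1 t ++ [:: w]) - F (nseq n.+1 c ++ [:: w])| <
    F (nseq n.+1 c ++ [:: b]) - F (nseq n.+1 c ++ [:: a]).
  move=> Iw; have Iw1 : strings I [:: w] by auto.
  have /within_continuous_epsP := F_cont n.+1 [:: w] Iw1 isT.
  by apply => //; rewrite subr_gt0.
have [d d_gt0 ad] := nearF a Ia; have [d' d'_gt0 bd] := nearF b Ib.
exists (Order.min d d'); first by rewrite lt_min d_gt0.
move=> t It; rewrite lt_min => /andP[/(ad t It) at_ /(bd t It) bt].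
have n0 : 0 < n.+1%:R :> R by rewrite ltr0n.
have tc : n.+1%:R * (f t - f c) <= 1.
  by apply: f_slope => //; move: at_; rewrite ltr_distl; lra.
have ct : n.+1%:R * (f c - f t) <= 1.
  by apply: f_slope => //; move: bt; rewrite ltr_distl; lra.
have en : 1 < n.+1%:R * e by rewrite -ltr_pdivrMr// div1r.
have le_e r : n.+1%:R * r <= 1 -> r < e.
  by move=> r1; rewrite -(ltr_pM2l n0) (le_lt_trans r1).
by rewrite ltr_distl; have := le_e _ tc; have := le_e _ ct; lra.
Qed.
End Representation.
End Ordering.

(** * From n-ary parts to strings *)

Section Bridge.
Context {R : realType} {I : set R}.

Definition tuple_row {n} (s : n.-tuple R) : 'rV[R]_n := \row_i tnth s i.

Lemma nary_part_tuple (F : seq R -> R) n (s : n.-tuple R) :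
  nary_part F n (tuple_row s) = F s.
Proof.
rewrite /nary_part -[in RHS](map_tnth_enum s); congr F.
by apply: eq_map => i; rewrite mxE.
Qed.

Lemma cube_tuple n (s : n.-tuple R) : strings I s -> cube I n (tuple_row s).
Proof. by move=> Is i; rewrite mxE; apply: Is; exact: mem_tnth. Qed.

Lemma strings_row n (x : 'rV[R]_n) :
  cube I n x -> strings I [seq x ord0 i | i <- enum 'I_n].
Proof. by move=> Ix _ /mapP[i _ ->]. Qed.

(** The topology of matrices is that of entrywise convergence. *)
Lemma tuple_row_continuous n (s : R -> n.-tuple R) :
  (forall i, continuous (fun t => tnth (s t) i)) ->
  continuous (fun t => tuple_row (s t)).
Proof.
move=> sc t; apply/cvg_ballP => e e0.
have near_i i : \forall t' \near t, ball (tnth (s t) i) e (tnth (s t') i).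
  by have /cvg_ballP := sc i t; exact.
have := filter_forall _ near_i; move=> /(_ (nbhs_filter t)).
apply: filterS => t' h; split=> // i j; rewrite !mxE; exact: h.
Qed.

End Bridge.

Section FromNary.
Context {R : realType} {I : set R} {F : seq R -> R}.
Hypothesis F_nary : forall n : nat, (1 <= n)%N ->
     [/\ symmetric_on I (nary_part F n),
         {within cube I n, continuous nary_part F n}
       & strictly_increasing_in_each_arg I (nary_part F n)].

Lemma symmetric_perm s t : strings I s -> perm_eq s t -> F s = F t.
Proof.
move=> Is st; have [/size0nil t0|t0] := posnP (size t).
  by move: st; rewrite t0 => /perm_nilP->.
have [sym _ _] := F_nary _ t0.
have It : strings I (in_tuple t) by move=> r; rewrite -(perm_mem st); exact: Is.
have /(tuple_permP (t := in_tuple t))[p ->] := st.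
rewrite -[RHS](nary_part_tuple F _ (in_tuple t)) -(sym p); last exact: cube_tuple.
rewrite -[LHS](nary_part_tuple F).
by congr nary_part; apply/rowP => i; rewrite !mxE tnth_mktuple.
Qed.

Lemma increasing_cons u v z : I u -> I v -> strings I z ->
  u < v -> F (u :: z) < F (v :: z).
Proof.
move=> Iu Iv Iz uv; have [_ _ incr] := F_nary (size z).+1 isT.
rewrite -[u :: z]/(tval [tuple of u :: in_tuple z]).
rewrite -[v :: z]/(tval [tuple of v :: in_tuple z]) -!nary_part_tuple.
apply: (incr ord0).
- by apply: cube_tuple; apply/strings_cons.
- by apply: cube_tuple; apply/strings_cons.
- by move=> j; case: (unliftP ord0 j) => [k ->|->//] _; rewrite !mxE !tnthS.
- by rewrite !mxE !tnth0.
Qed.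

Lemma continuous_nseq_cat n z : strings I z -> (0 < n + size z)%N ->
  {within I, continuous (fun t => F (nseq n t ++ z))}.
Proof.
move=> Iz n0; have [_ cF _] := F_nary _ n0.
pose s t : (n + size z).-tuple R := [tuple of nseq n t ++ in_tuple z].
rewrite (_ : (fun t => _) = fun t => nary_part F _ (tuple_row (s t))); last first.
  by apply/funext => t; rewrite nary_part_tuple.
move/subspace_continuousP : cF => cF; apply/subspace_continuousP => c Ic.
have Is t : I t -> cube I _ (tuple_row (s t)).
  by move=> It; apply: cube_tuple; apply: strings_cat => //; exact: strings_nseq.
have cs : continuous (fun t => tuple_row (s t)).
  apply: tuple_row_continuous => i.
  have [lt|ge] := ltnP i n.
    rewrite (_ : (fun t => _) = id); first by move=> ?; exact: cvg_id.
    apply/funext => t; rewrite (tnth_nth 0)/= nth_cat size_nseq lt.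
    by rewrite nth_nseq lt.
  rewrite (_ : (fun t => _) = fun=> nth 0 z (i - n)); first exact: cst_continuous.
  apply/funext => t; rewrite (tnth_nth 0)/= nth_cat size_nseq ltnNge ge//.
move=> A /(cF _ (Is c Ic)) /cs; rewrite !nbhs_simpl /=.
by apply: filterS => t h It; exact: h (Is t It).
Qed.

End FromNary.

(** * Quasi-arithmetic representation *)

(** With f from [additive_representation] and g its inverse on f(I), the outer
    function f_n sends r to the value of F at g r ... g r; it is determined by
    the diagonal, since every string is equivalent to a constant one. *)
Lemma representation_of_preassociative {R : realType} {I : set R} {F : seq R -> R} :
  nontrivial_interval I -> B_preassociative I F ->
  (forall n : nat, (1 <= n)%N ->
     [/\ symmetric_on I (nary_part F n),
         {within cube I n, continuous nary_part F n}
       & strictly_increasing_in_each_arg I (nary_part F n)]) ->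
  exists (f : R -> R) (fn : nat -> R -> R),
    [/\ continuous_strictly_increasing_on I f,
        forall n : nat, (1 <= n)%N ->
          continuous_strictly_increasing_on (f @` I) (fn n)
      & forall (n : nat) (x : 'rV[R]_n), (1 <= n)%N -> cube I n x ->
          nary_part F n x = fn n (n%:R^-1 * \sum_(i < n) f (x ord0 i))].
Proof.
move=> [I_itv [a0 Ia0] I_nt] F_B F_nary.
have F_preassoc x y z : strings I x -> strings I y -> strings I z ->
    size x = size y -> F x = F y -> F (x ++ z) = F (y ++ z).
  by move=> Ix Iy Iz; exact: (F_B [::]).
have [a [b [Ia Ib ab]]] : exists a b, [/\ I a, I b & a < b].
  have [b0 Ib0 ab0] : exists2 b, I b & b != a0.
    apply: contrapT => no; apply: (I_nt a0); apply/seteqP; split=> [t It|_ ->//].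
    by apply/eqP/negPn/negP => ta; apply: no; exists t.
  by move: ab0; rewrite neq_lt => /orP[lt|lt]; [exists b0, a0|exists a0, b0].
have F_perm := symmetric_perm F_nary.
have F_mono := increasing_cons F_nary.
have F_cont := continuous_nseq_cat F_nary.
have [f [[f_cont f_mono] f_le]] :=
  additive_representation I_itv F_perm F_mono F_cont F_preassoc Ia Ib ab.
pose g r := xget 0 [set t | I t /\ f t = r].
have f_inj x y : I x -> I y -> f x = f y -> x = y.
  move=> Ix Iy E; have [xy|yx|//] := ltgtP x y.
    by have := f_mono _ _ Ix Iy xy; rewrite E ltxx.
  by have := f_mono _ _ Iy Ix yx; rewrite E ltxx.
have gK t : I t -> g (f t) = t.
  move=> It; have [Ig fg] : [set s | I s /\ f s = f t] (g (f t)).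
    by apply: xgetPex; exists t.
  exact: f_inj.
have diag_lt n x y : I x -> I y -> x < y -> F (nseq n.+1 x) < F (nseq n.+1 y).
  move=> Ix Iy xy.
  have := nseq_cat_lt F_perm F_mono n.+1 x y [::] isT Ix Iy strings_nil xy.
  by rewrite !cats0.
exists f, (fun n r => F (nseq n (g r))); split=> //.
- case=> // n _.
  have mono x y : (f @` I) x -> (f @` I) y -> x < y ->
      F (nseq n.+1 (g x)) < F (nseq n.+1 (g y)).
    move=> [s Is <-] [t It <-] fst; rewrite !gK//; apply: diag_lt => //.
    rewrite ltNge le_eqVlt; apply/negP => /predU1P[ts|ts].
      by move: fst; rewrite ts ltxx.
    by have := f_mono _ _ It Is ts; lra.
  split=> //; apply: increasing_interval_continuous => //.
  rewrite (_ : _ @` _ = (fun t => F (nseq n.+1 t ++ [::])) @` I).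
    by apply: image_interval => //; exact: F_cont.
  rewrite image_comp; apply: eq_imagel => t It /=.
  by rewrite gK// cats0.
- move=> n x n0 Ix; rewrite /nary_part.
  set s := [seq _ | _ <- _].
  have sn : size s = n by rewrite size_map size_enum_ord.
  have Is : strings I s by exact: strings_row.
  have [|m Im sm] := diagonal_mean I_itv F_perm F_mono F_cont F_preassoc s Is.
    by rewrite sn.
  have Ism := strings_nseq n m Im.
  (* Equal values are comparable both ways, hence have equal sums. *)
  have : \sum_(t <- s) f t = \sum_(t <- nseq n m) f t.
    by apply/eqP; rewrite sn in sm; rewrite eq_le !f_le// ?sm ?lexx ?size_nseq.
  rewrite big_nseq iter_addr_0 -(mulr_natl (f m)) big_map big_enum/= => ->.
  rewrite mulKf ?gK ?sm ?sn// pnatr_eq0; lia.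
Qed.

Lemma mean_in_interval {R : realType} (A : set R) n (y : 'I_n -> R) :
  is_interval A -> (0 < n)%N -> (forall i, A (y i)) ->
  A (n%:R^-1 * \sum_(i < n) y i).
Proof.
move=> A_itv; case: n y => // n y _ Ay; set m := _ * _.
have n0 : 0 < n.+1%:R :> R by rewrite ltr0n.
have mE : \sum_(i < n.+1) m = \sum_(i < n.+1) y i.
  by rewrite sumr_const card_ord -mulr_natl mulVKf ?gt_eqF.
have [i im] : exists i, y i <= m.
  apply: contrapT => no; have : \sum_(i < n.+1) m < \sum_(i < n.+1) y i.
    apply: ltr_sum; first by apply/hasP; exists ord0; rewrite ?mem_index_enum.
    by move=> k _; rewrite ltNge; apply/negP => le; apply: no; exists k.
  by rewrite mE ltxx.
have [j jm] : exists j, m <= y j.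
  apply: contrapT => no; have : \sum_(i < n.+1) y i < \sum_(i < n.+1) m.
    apply: ltr_sum; first by apply/hasP; exists ord0; rewrite ?mem_index_enum.
    by move=> k _; rewrite ltNge; apply/negP => le; apply: no; exists k.
  by rewrite mE ltxx.
by apply: (A_itv (y i) (y j)); rewrite ?im.
Qed.

(** On f(I), which contains all means of f, the function f_n is injective; thus
    F y = F y' amounts to an equality of sums of f, and adding the same terms to
    both sides preserves it.  The other properties pass through the sum. *)
Lemma preassociative_of_representation {R : realType} {I : set R}
    {F : seq R -> R} {f : R -> R} {fn : nat -> R -> R} :
  is_interval I -> continuous_strictly_increasing_on I f ->
  (forall n : nat, (1 <= n)%N ->
    continuous_strictly_increasing_on (f @` I) (fn n)) ->
  (forall (n : nat) (x : 'rV[R]_n), (1 <= n)%N -> cube I n x ->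
          nary_part F n x = fn n (n%:R^-1 * \sum_(i < n) f (x ord0 i))) ->
  B_preassociative I F /\
   forall n : nat, (1 <= n)%N ->
     [/\ symmetric_on I (nary_part F n),
         {within cube I n, continuous nary_part F n}
       & strictly_increasing_in_each_arg I (nary_part F n)].
Proof.
move=> I_itv [f_cont f_mono] fn_ok F_repr.
have fI : is_interval (f @` I) by exact: image_interval.
have F_seq s : (0 < size s)%N -> strings I s ->
    (f @` I) ((size s)%:R^-1 * \sum_(t <- s) f t) /\
    F s = fn (size s) ((size s)%:R^-1 * \sum_(t <- s) f t).
  move=> s0 Is; have cs := cube_tuple _ (in_tuple s) Is.
  have -> : \sum_(t <- s) f t = \sum_(i < size s) f (tnth (in_tuple s) i).
    by rewrite -(big_tnth _ _ _ xpredT).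
  split.
    apply: mean_in_interval => // i.
    by exists (tnth (in_tuple s) i) => //; exact/Is/mem_tnth.
  have := F_repr _ _ s0 cs; rewrite nary_part_tuple => ->.
  by congr (fn _ (_ * _)); apply: eq_bigr => i _; rewrite mxE.
have fn_inj n r r' : (0 < n)%N -> (f @` I) r -> (f @` I) r' ->
    fn n r = fn n r' -> r = r'.
  move=> n0 fr fr' E; have [_ fn_mono] := fn_ok _ n0.
  have [lt|lt|//] := ltgtP r r'.
    by have := fn_mono _ _ fr fr' lt; rewrite E ltxx.
  by have := fn_mono _ _ fr' fr lt; rewrite E ltxx.
split.
  move=> x y y' z Ix Iy Iy' Iz yy' E.
  have [y0|y0] := posnP (size y).
    by rewrite (size0nil y0) (size0nil (esym (etrans (esym y0) yy'))).
  have y'0 : (0 < size y')%N by rewrite -yy'.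
  have sumE : \sum_(t <- y) f t = \sum_(t <- y') f t.
    have [My Fy] := F_seq y y0 Iy; have [My' Fy'] := F_seq y' y'0 Iy'.
    apply: (@mulfI _ (size y)%:R^-1); first by rewrite invr_neq0// pnatr_eq0 -lt0n.
    rewrite -yy' in My' Fy'; rewrite Fy Fy' in E.
    exact: (fn_inj (size y)).
  have [||_ ->] := F_seq (x ++ y ++ z).
  - by rewrite !size_cat; lia.
  - by do 2![apply: strings_cat => //].
  have [||_ ->] := F_seq (x ++ y' ++ z).
  - by rewrite !size_cat; lia.
  - by do 2![apply: strings_cat => //].
  by rewrite !size_cat yy' !big_cat/= sumE.
move=> n n0; have [fn_cont fn_mono] := fn_ok n n0.
have mean_fI x : cube I n x -> (f @` I) (n%:R^-1 * \sum_(i < n) f (x ord0 i)).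
  by move=> Ix; apply: mean_in_interval => // i; exists (x ord0 i).
split.
- move=> s x Ix; have Isx : cube I n (col_perm s x) by move=> i; rewrite mxE.
  rewrite !F_repr//; congr (fn _ (_ * _)).
  rewrite [RHS](reindex_inj (@perm_inj _ s)).
  by apply: eq_bigr => i _; rewrite mxE.
- move/subspace_continuousP : fn_cont => fn_cont.
  move/subspace_continuousP : f_cont => f_cont.
  apply/subspace_continuousP => x Ix.
  have sum_cvg :
      (n%:R^-1 * \sum_(i < n) f (y ord0 i)) @[y --> within (cube I n) (nbhs x)]
      --> n%:R^-1 * \sum_(i < n) f (x ord0 i).
    apply: cvgMr; apply: cvg_big; first exact: add_continuous.
    move=> i _ A /(f_cont _ (Ix i)) /(@coord_continuous R _ _ ord0 i x).
    rewrite !nbhs_simpl /=.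
    by apply: filterS => y h Iy; exact: h (Iy i).
  suff : nary_part F n y @[y --> within (cube I n) (nbhs x)] -->
    nary_part F n x by [].
  move=> A; rewrite F_repr// => /(fn_cont _ (mean_fI x Ix)) /sum_cvg.
  rewrite !nbhs_simpl /=; apply: (@filterS _ (nbhs x)) => y h Iy; rewrite /= F_repr//.
  exact: (h Iy (mean_fI y Iy)).
- move=> i x y Ix Iy xy lt; rewrite !F_repr//; apply: fn_mono; [exact: mean_fI..|].
  rewrite ltr_pM2l ?invr_gt0 ?ltr0n// (bigD1 i)//= [ltRHS](bigD1 i)//=.
  rewrite (eq_bigr (fun j => f (y ord0 j))); last by move=> j /xy ->.
  by rewrite ltrD2r f_mono.
Qed.

Theorem theorem4p14 (R : realType) (I : set R) (F : seq R -> R)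
    (hI : nontrivial_interval I) :
  (B_preassociative I F /\
   forall n : nat, (1 <= n)%N ->
     [/\ symmetric_on I (nary_part F n),
         {within cube I n, continuous nary_part F n}
       & strictly_increasing_in_each_arg I (nary_part F n)])
  <->
  (exists (f : R -> R) (fn : nat -> R -> R),
    [/\ continuous_strictly_increasing_on I f,
        forall n : nat, (1 <= n)%N ->
          continuous_strictly_increasing_on (f @` I) (fn n)
      & forall (n : nat) (x : 'rV[R]_n), (1 <= n)%N -> cube I n x ->
          nary_part F n x = fn n (n%:R^-1 * \sum_(i < n) f (x ord0 i))]).
Proof.
split=> [[F_B F_nary]|[f [fn [f_ok fn_ok F_repr]]]].
  exact: representation_of_preassociative.
have [I_itv _ _] := hI.
exact: (preassociative_of_representation I_itv f_ok fn_ok F_repr).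
Qed.
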